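(* Let $\mathcal{P}=\{1,\dots,\mathrm{N}\}$ and consider the system $X_{t+1}=f_{\sigma_t}(X_t,w_t)$, $X_0=x_0\in\mathbb{R}^d$, $t\in\mathbb{N}_0$, where each $f_i:\mathbb{R}^d\times\mathbb{R}^m\to\mathbb{R}^d$ is locally Lipschitz continuous in both arguments with $f_i(0,0)=0$ for $i\in\mathcal{P}$, and $(w_t)_{t\in\mathbb{N}_0}$ is a bounded (deterministic) $\mathbb{R}^m$-valued disturbance sequence. Suppose that (i) $(\sigma_t)_{t\in\mathbb{N}_0}$ is an irreducible Markov chain on $\mathcal{P}$ with initial distribution $\pi^\circ$ and transition matrix $[p_{ij}]_{\mathrm{N}\times\mathrm{N}}$; (ii) there exist continuous functions $V_i:\mathbb{R}^d\to[0,\infty[$ for $i\in\mathcal{P}$, functions $\alpha_1,\alpha_2,\rho\in\mathcal{K}_\infty$, a constant $\mu>1$ and a matrix $[\lambda_{ij}]_{\mathrm{N}\times\mathrm{N}}$ of nonnegative entries such that (a) $\alpha_1(\|x\|)\le V_i(x)\le\alpha_2(\|x\|)$ for all $x\in\mathbb{R}^d$ and $i\in\mathcal{P}$, (b) $V_i(x)\le\mu V_j(x)$ for all $x\in\mathbb{R}^d$ and $i,j\in\mathcal{P}$, (c) $V_i(f_j(x,w))\le\lambda_{ij}V_i(x)$ whenever $\|x\|>\rho(\|w\|)$, for all $i,j\in\mathcal{P}$; (iii) $\mu\bigl(\max_{i\in\mathcal{P}}\sum_{j\in\mathcal{P}}p_{ij}\lambda_{ji}\bigr)<1$. Then the system is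 input-to-state stable in $L_1$.
   Context: $\mathbb{N}_0=\{0,1,2,\dots\}$; $\|\cdot\|$ is the Euclidean norm. $\mathcal{K}$ is the set of strictly increasing continuous $\alpha:[0,\infty[\to[0,\infty[$ with $\alpha(0)=0$; $\mathcal{K}_\infty$ is the set of $\alpha\in\mathcal{K}$ with $\alpha(r)\to\infty$ as $r\to\infty$; $\mathcal{KL}$ is the set of $\psi:[0,\infty[\times\mathbb{N}_0\to[0,\infty[$ with $\psi(\cdot,n)\in\mathcal{K}$ for each fixed $n$ and $\psi(r,n)\to0$ as $n\to\infty$ for each fixed $r$. The system is input-to-state stable in $L_1$ if there exist $\chi,\chi'\in\mathcal{K}_\infty$ and $\psi\in\mathcal{KL}$ such that, for every initial condition $x_0\in\mathbb{R}^d$ and every bounded disturbance sequence $(w_t)$, $\mathsf{E}_{x_0}[\chi(\|X_t\|)]\le\psi(\|x_0\|,t)+\sup_{s\in\mathbb{N}_0}\chi'(\|w_s\|)$ for all $t\in\mathbb{N}_0$. Here $\mathsf{E}_{x_0}$ is the expectation (over the law of $\sigma$) with $X_0=x_0$. *)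

(* Defs.v *)
From HB Require Import structures.
From mathcomp Require Import all_boot all_order all_algebra.
From mathcomp Require Import all_classical all_reals all_analysis.

Set Implicit Arguments.
Unset Strict Implicit.
Unset Printing Implicit Defensive.

Import Order.TTheory GRing.Theory Num.Theory.
Import numFieldNormedType.Exports.

Local Open Scope classical_set_scope.
Local Open Scope ring_scope.

(* The norm `|x| that the library puts on 'rV[R]_n is the maximum norm. *)
Definition enorm (R : realType) (n : nat) (x : 'rV[R]_n) : R :=
  Num.sqrt (\sum_(i < n) x ord0 i ^+ 2).

(* Functions on [0, +oo[ are represented by functions on R whose values at
   negative arguments are irrelevant. *)
Definition class_K (R : realType) (alpha : R -> R) : Prop :=
  [/\ forall r, 0 <= r -> 0 <= alpha r,
      {within `[0, +oo[, continuous alpha},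
      {in `[0, +oo[ &, {homo alpha : r s / r < s}} &
      alpha 0 = 0].

Definition class_Koo (R : realType) (alpha : R -> R) : Prop :=
  class_K alpha /\ alpha r @[r --> +oo] --> +oo.

Definition class_KL (R : realType) (psi : R -> nat -> R) : Prop :=
  (forall n, class_K (psi ^~ n)) /\
  (forall r, 0 <= r -> psi r n @[n --> \oo] --> 0).

(* As all norms on R^d * R^m and on R^d are equivalent, it does not matter that
   the library's notion of Lipschitz function refers to maximum norms. *)
Definition locally_lipschitz (R : realType) (d m : nat)
    (g : 'rV[R]_d -> 'rV[R]_m -> 'rV[R]_d) : Prop :=
  forall z0 : 'rV[R]_d * 'rV[R]_m,
    exists2 U : set ('rV[R]_d * 'rV[R]_m),
      nbhs z0 U & [lipschitz (g z.1 z.2) | z in U].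

Definition prob_vector (R : realType) (N : nat) (q : 'rV[R]_N) : Prop :=
  (forall i, 0 <= q ord0 i) /\ \sum_(i < N) q ord0 i = 1.

Definition cond_prob (disp : measure_display) (Omega : measurableType disp)
    (R : realType) (P : probability Omega R) (A B : set Omega) : R :=
  fine (P (A `&` B)) / fine (P B).

(* The states 1, ..., N are the elements of 'I_N.  In the last clause h 0, ..., h t
   is the past up to time t. *)
Definition markov_chain (disp : measure_display) (Omega : measurableType disp)
    (R : realType) (P : probability Omega R) (N : nat)
    (sigma : nat -> Omega -> 'I_N) (pi0 : 'rV[R]_N) (p : 'M[R]_N) : Prop :=
  [/\ forall t i, measurable (sigma t @^-1` [set i]),
      prob_vector pi0 /\ (forall i, prob_vector (row i p)),
      forall i, P (sigma 0%N @^-1` [set i]) = (pi0 ord0 i)%:E &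
      forall (t : nat) (h : nat -> 'I_N) (j : 'I_N),
        let past := [set omega | forall s, (s <= t)%N -> sigma s omega = h s] in
        P past != 0%E ->
        cond_prob P (sigma t.+1 @^-1` [set j]) past = p (h t) j].

Definition irreducible (R : realType) (N : nat) (p : 'M[R]_N) : Prop :=
  forall i j : 'I_N, exists n : nat, 0 < (p ^+ n) i j.

Fixpoint trajectory (R : realType) (d m N : nat) (Omega : Type)
    (f : 'I_N -> 'rV[R]_d -> 'rV[R]_m -> 'rV[R]_d)
    (sigma : nat -> Omega -> 'I_N) (w : nat -> 'rV[R]_m) (x0 : 'rV[R]_d)
    (t : nat) (omega : Omega) : 'rV[R]_d :=
  if t is s.+1 then
    f (sigma s omega) (trajectory f sigma w x0 s omega) (w s)
  else x0.

Definition iss_L1 (disp : measure_display) (Omega : measurableType disp)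
    (R : realType) (P : probability Omega R) (d m N : nat)
    (f : 'I_N -> 'rV[R]_d -> 'rV[R]_m -> 'rV[R]_d)
    (sigma : nat -> Omega -> 'I_N) : Prop :=
  exists (chi chi' : R -> R) (psi : R -> nat -> R),
    [/\ class_Koo chi, class_Koo chi', class_KL psi &
      forall (x0 : 'rV[R]_d) (w : nat -> 'rV[R]_m), bounded_fun w ->
        forall t : nat,
          ('E_P[fun omega => chi (enorm (trajectory f sigma w x0 t omega))]
           <= (psi (enorm x0) t)%:E
              + ereal_sup (range (fun s : nat => (chi' (enorm (w s)))%:E)))%E].

(* Main.v *)
(* Let c < 1 bound mu * max_i sum_j p_ij lambda_ji.  If ||X_t|| > rho(||w_t||),
   then, given the modes sigma_0, ..., sigma_t, the inequality
     V_j(f_i(x, w)) <= lambda_ji V_j(x) <= mu lambda_ji V_i(x)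
   averaged over j = sigma_{t+1} shows that V_{sigma_{t+1}}(X_{t+1}) has
   conditional expectation at most c V_{sigma_t}(X_t).  Otherwise
   ||X_t|| <= rho(||w_t||), and V_j(f_i(X_t, w_t)) <= (1 - c) chi'(||w_t||) for a
   suitable chi' in K_oo, by continuity of V_j o f_i.  Iterating
     E V_{t+1} <= c E V_t + (1 - c) sup_s chi'(||w_s||)
   gives E V_t <= c^t V_0 + sup_s chi'(||w_s||), and alpha1(||X_t||) <= V_t.
   Conditional expectations are replaced by integrals over the cylinder events
   {sigma_0 = h_0, ..., sigma_t = h_t}. *)

Require Import Defs.
From HB Require Import structures.
From mathcomp Require Import all_boot all_order all_algebra.
From mathcomp Require Import all_classical all_reals all_analysis.
From mathcomp Require Import measurable_realfun.
From mathcomp Require Import ring lra.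

Set Implicit Arguments.
Unset Strict Implicit.
Unset Printing Implicit Defensive.

Import Order.TTheory GRing.Theory Num.Theory.
Import numFieldNormedType.Exports.

Local Open Scope classical_set_scope.
Local Open Scope ring_scope.

(** * Norms, compactness, and majorants of class K_oo *)

Lemma enorm_ge0 (R : realType) (n : nat) (x : 'rV[R]_n) : 0 <= enorm x.
Proof. exact: sqrtr_ge0. Qed.

Lemma enorm0 (R : realType) (n : nat) : enorm (0 : 'rV[R]_n) = 0.
Proof.
by rewrite /enorm big1 ?sqrtr0// => i _; rewrite mxE expr0n.
Qed.

Lemma normr_le_enorm (R : realType) (n : nat) (x : 'rV[R]_n) :
  `|x| <= enorm x.
Proof.
rewrite /enorm [`|x|]mx_normrE; apply: bigmax_le => [|[i j] _].
  exact: sqrtr_ge0.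
rewrite (ord1 i) /= -sqrtr_sqr ler_sqrt; last first.
  by apply: sumr_ge0 => k _; exact: sqr_ge0.
by rewrite (bigD1 j)//= lerDl sumr_ge0// => k _; exact: sqr_ge0.
Qed.

Lemma locally_lipschitz_continuous (R : realType) (d m : nat)
    (g : 'rV[R]_d -> 'rV[R]_m -> 'rV[R]_d) :
  locally_lipschitz g -> continuous (fun z : 'rV[R]_d * 'rV[R]_m => g z.1 z.2).
Proof.
move=> glip z0; have [U Uz0 [M0 [_ glipU]]] := glip z0.
(* [M0] is only a threshold above which every number is a Lipschitz constant, and it may be
   negative; [M] exceeds it and is positive. *)
pose M := Num.max (M0 + 1) 1.
have M_gt0 : 0 < M by rewrite lt_max ltr01 orbT.
have {}glipU := glipU M _.
apply/cvgrPdist_le => e e0; near=> z.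
apply: le_trans (glipU _ (z0, z) _) _ => /=.
- by rewrite lt_max ltrDl ltr01.
- by split; [exact: nbhs_singleton|near: z; exact: Uz0].
- rewrite -ler_pdivlMl//; near: z.
  by apply: cvgr_dist_le; [exact: cvg_id | rewrite mulr_gt0// invr_gt0].
Unshelve. all: by end_near. Qed.

(** The norm of a pair is the larger of the two norms, so the ball is a product of two closed
    bounded sets in finite dimension. *)
Lemma compact_prod_ball (R : realType) (d m : nat) (r : R) :
  compact [set z : 'rV[R]_d * 'rV[R]_m | `|z| <= r].
Proof.
have ballK n : compact [set x : 'rV[R]_n | `|x| <= r].
  apply: bounded_closed_compact.
    by exists r; split; [exact: num_real|move=> s rs x /= /le_trans; apply; exact: ltW].
  rewrite (_ : [set x | _] = (fun x : 'rV[R]_n => `|x|) @^-1` [set t | t <= r])//.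
  apply: preimage_closed; last exact: closed_le.
  by move=> x _; exact: norm_continuous.
rewrite (_ : [set z | _] =
    [set x : 'rV[R]_d | `|x| <= r] `*` [set x : 'rV[R]_m | `|x| <= r]).
  exact: compact_setX.
by apply/seteqP; split => -[x w] /=; rewrite prod_normE /= ge_max => /andP.
Qed.

(** Joint continuity and compactness of [K] make [h s] converge to [h s0] uniformly on [K], and a
    uniform error [e] moves the supremum by at most [e]. *)
Lemma sup_compact_continuous (R : realType) (S T : topologicalType)
    (K : set T) (h : S -> T -> R) :
  compact K -> K !=set0 -> continuous (fun z : S * T => h z.1 z.2) ->
  continuous (fun s => sup [set h s u | u in K]).
Proof.
move=> cK K0 hc s0.
have hsup s : has_sup [set h s u | u in K].
  apply: compact_has_sup; first by have [u Ku] := K0; exists (h s u), u.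
  apply: continuous_compact => //; apply: continuous_subspaceT => u.
  apply: (@cvg_comp _ _ _ (fun v => (s, v)) (fun z => h z.1 z.2) _
    (nbhs (s, u)) _ _ (hc (s, u))).
  by apply: cvg_pair; [exact: cvg_cst|exact: cvg_id].
apply/cvgrPdist_le => e e0.
suff : \forall s \near s0, K `<=` [set u | `|h s0 u - h s u| <= e].
  apply: filterS => s Ks; rewrite ler_distl; apply/andP; split.
    rewrite lerBlDr; apply: ge_sup; first exact: (hsup s).1.
    move=> _ [u Ku <-]; rewrite -lerBlDr.
    apply: le_trans (ub_le_sup (hsup s0).2 _); last by exists u; [exact: Ku|].
    by have := Ks u Ku; rewrite /= ler_distl => /andP[].
  apply: ge_sup; first exact: (hsup s0).1.
  move=> _ [u Ku <-]; rewrite -lerBlDr.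
  apply: le_trans (ub_le_sup (hsup s).2 _); last by exists u; [exact: Ku|].
  by have := Ks u Ku; rewrite /= ler_distl -lerBlDr => /andP[].
(* For [(s, v)] near [(s0, u)], both [h s v] and [h s0 v] lie within [e / 2] of [h s0 u];
   compactness makes the neighbourhood of [s0] uniform in [u]. *)
move/compact_near_coveringP : cK; apply => u Ku.
have e2 : 0 < e / 2 by rewrite divr_gt0.
have /cvgrPdist_le/(_ _ e2) [[A B] [/= s0A uB] AB] := hc (s0, u).
exists (B, A) => //= -[v s] [/= Bv As].
have h1 := AB (s, v) (conj As Bv).
have h2 := AB (s0, v) (conj (nbhs_singleton s0A) Bv).
rewrite /= in h1 h2.
have -> : h s0 v - h s v = (h s0 u - h s v) - (h s0 u - h s0 v).
  by rewrite opprB [RHS]addrC addrA subrK.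
by rewrite (splitr e); exact: le_trans (ler_normB _ _) (lerD h1 h2).
Qed.

(** Provides the gain [chi'] where the state is too small for the decrease condition: there [w]
    controls the norm of [(x, w)], and [g] is bounded on balls. *)
Lemma class_Koo_majorant (R : realType) (d m : nat)
    (g : 'rV[R]_d * 'rV[R]_m -> R) (rho : R -> R) :
  continuous g -> (forall z, 0 <= g z) -> g 0 = 0 -> class_Koo rho ->
  exists2 chi, class_Koo chi & forall (x : 'rV[R]_d) (w : 'rV[R]_m),
    enorm x <= rho (enorm w) -> g (x, w) <= chi (enorm w).
Proof.
move=> g_cont g_ge0 g0 [[rho_ge0 rho_cont rho_incr rho0] _].
pose B := [set u : 'rV[R]_d * 'rV[R]_m | `|u| <= 1].
have B0 : B 0 by rewrite /B /= normr0 ler01.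
(* G s is the supremum of g over the ball of radius s; rescaling to the fixed
   compact B makes its continuity an instance of sup_compact_continuous. *)
pose G (s : R) := sup [set g (s *: u) | u in B].
have scale_cont : continuous (fun z : R * ('rV[R]_d * 'rV[R]_m) => g (z.1 *: z.2)).
  move=> z; apply: (@cvg_comp _ _ _ (fun z => z.1 *: z.2) g _ (nbhs (z.1 *: z.2))).
    by apply: cvgZ; [exact: cvg_fst|exact: cvg_snd].
  exact: g_cont.
have G_cont : continuous G.
  by apply: sup_compact_continuous scale_cont;
    [exact: compact_prod_ball|exists 0].
have G_sup s : has_sup [set g (s *: u) | u in B].
  apply: compact_has_sup; first by exists (g (s *: 0)), 0.
  apply: continuous_compact; last exact: compact_prod_ball.
  apply: continuous_subspaceT => u.
  apply: (@cvg_comp _ _ _ (fun v => s *: v) g _ (nbhs (s *: u))).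
    by apply: cvgZr; exact: cvg_id.
  exact: g_cont.
have G_ub s z : 0 <= s -> `|z| <= s -> g z <= G s.
  rewrite le_eqVlt => /predU1P[<-|s0] zs.
    have -> : z = 0 by apply/eqP; rewrite -normr_le0.
    by apply: (ub_le_sup (G_sup 0).2); exists 0; rewrite ?scale0r.
  apply: (ub_le_sup (G_sup s).2); exists (s^-1 *: z).
    by rewrite /B /= normrZ gtr0_norm ?invr_gt0// ler_pdivrMl// mulr1.
  by rewrite scalerA mulfV ?gt_eqF// scale1r.
have G_incr s t : 0 <= s -> s <= t -> G s <= G t.
  move=> s0 st; apply: ge_sup; first exact: (G_sup s).1.
  move=> _ [u Bu <-]; apply: G_ub; first exact: le_trans st.
  rewrite normrZ ger0_norm//; apply: le_trans st.
  by rewrite -[leRHS]mulr1 ler_wpM2l.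
have G_ge0 s : 0 <= s -> 0 <= G s.
  by move=> s0; apply: le_trans (G_ub s 0 s0 _); rewrite ?normr0.
have G0 : G 0 = 0.
  apply/le_anti/andP; split; last exact: G_ge0.
  apply: ge_sup; first exact: (G_sup 0).1.
  by move=> _ [u _ <-]; rewrite scale0r g0.
(* The radius [rho r + r] bounds both components of [(x, w)]; since [G] is merely nondecreasing, the
   last [r] supplies strict growth and divergence. *)
pose chi r := G (rho r + r) + r.
exists chi; last first.
  move=> x w xw; have w0 := enorm_ge0 w; have rw0 := rho_ge0 _ w0.
  rewrite /chi; apply: ler_wpDr => //; apply: G_ub; first exact: addr_ge0.
  rewrite prod_normE ge_max /=; apply/andP; split.
    by apply: le_trans (normr_le_enorm _) _; apply: ler_wpDr.
  by apply: le_trans (normr_le_enorm _) _; apply: ler_wpDl.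
split; first split.
- move=> r r0; have rr0 := rho_ge0 _ r0.
  by rewrite /chi addr_ge0// G_ge0// addr_ge0.
- have id_cont : {within `[0, +oo[, continuous (@idfun R)}.
    by apply: continuous_subspaceT => r; exact: cvg_id.
  apply: within_continuousD => //.
  move=> r; apply: (@cvg_comp _ _ _ (fun r => rho r + r) G _ (nbhs (rho r + r))).
    exact: (within_continuousD rho_cont id_cont).
  exact: G_cont.
- move=> r s; rewrite !in_itv /= !andbT => r0 s0 rs.
  have rho_rs : rho r < rho s by apply: rho_incr; rewrite ?in_itv /= ?r0 ?s0.
  rewrite /chi ler_ltD// G_incr ?addr_ge0 ?rho_ge0//.
  exact: ltW (ltrD rho_rs rs).
- by rewrite /chi rho0 !addr0 G0.
- apply: (@ger_cvgy _ _ _ _ (@idfun R)); last exact: cvg_id.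
  near=> r; rewrite /chi lerDr; apply: G_ge0.
  have r0 : 0 <= r by near: r; exact: nbhs_pinfty_ge.
  by rewrite addr_ge0 ?rho_ge0.
Unshelve. all: by end_near. Qed.

(** * Geometric decay in class KL *)

Lemma class_K_scale (R : realType) (k : R) (alpha : R -> R) :
  0 < k -> class_K alpha -> class_K (fun r => k * alpha r).
Proof.
move=> k0 [alpha_ge0 alpha_cont alpha_incr alpha0]; split.
- by move=> r r0; rewrite mulr_ge0 ?alpha_ge0// ltW.
- by move=> r; apply: cvgMr; exact: alpha_cont.
- by move=> r s r0 s0 rs; rewrite ltr_pM2l// alpha_incr.
- by rewrite alpha0 mulr0.
Qed.

Lemma class_KL_geometric (R : realType) (k : R) (alpha : R -> R) :
  0 < k < 1 -> class_K alpha -> class_KL (fun r n => k ^+ n * alpha r).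
Proof.
move=> /andP[k0 k1] alphaK; split=> [n|r _].
  by apply: class_K_scale; rewrite ?exprn_gt0.
rewrite -[X in _ --> X](mul0r (alpha r)); apply: cvgMl.
by apply: cvg_expr; rewrite gtr0_norm.
Qed.

(** * Cylinder events of the Markov chain *)

Definition history (Omega : Type) (N : nat) (sigma : nat -> Omega -> 'I_N)
    (h : nat -> 'I_N) (t : nat) : set Omega :=
  [set omega | forall s, (s <= t)%N -> sigma s omega = h s].

Definition extend (N : nat) (h : nat -> 'I_N) (t : nat) (j : 'I_N) : nat -> 'I_N :=
  fun s => if s == t.+1 then j else h s.

Lemma historyS (Omega : Type) (N : nat) (sigma : nat -> Omega -> 'I_N) h t j :
  history sigma (extend h t j) t.+1 =
  (sigma t.+1 @^-1` [set j]) `&` history sigma h t.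
Proof.
apply/seteqP; split => [omega hist|omega [/= sj hist] s].
  split=> /= [|s st]; first by rewrite hist// /extend eqxx.
  by rewrite hist ?leqW// /extend ltn_eqF.
by rewrite leq_eqVlt /extend => /predU1P[->|st]; rewrite ?eqxx// ltn_eqF// hist.
Qed.

Lemma measurable_history (disp : measure_display) (Omega : measurableType disp)
    (N : nat) (sigma : nat -> Omega -> 'I_N) h t :
  (forall t i, measurable (sigma t @^-1` [set i])) ->
  measurable (history sigma h t).
Proof.
move=> sigma_meas; elim: t => [|t IH].
  rewrite (_ : history _ _ _ = sigma 0%N @^-1` [set h 0%N])//.
  apply/seteqP; split => omega /= => [|h0 s]; first exact.
  by rewrite leqn0 => /eqP ->.
rewrite (_ : history _ _ _ = history sigma (extend h t (h t.+1)) t.+1).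
  by rewrite historyS; exact: measurableI.
congr (history sigma _ _); apply/funext => s; rewrite /extend.
by case: eqP => // ->.
Qed.

(** Replaces conditioning on a mode: the finitely many fibres of [g] partition [A]. *)
Lemma ge0_integral_states (disp : measure_display) (Omega : measurableType disp)
    (R : realType) (P : {measure set Omega -> \bar R}) (N : nat)
    (g : Omega -> 'I_N) (A : set Omega) (F : Omega -> \bar R) :
  measurable A -> (forall i, measurable (g @^-1` [set i])) ->
  measurable_fun A F -> (forall omega, A omega -> (0 <= F omega)%E) ->
  (\int[P]_(omega in A) F omega =
   \sum_(i < N) \int[P]_(omega in g @^-1` [set i] `&` A) F omega)%E.
Proof.
move=> mA mg mF F_ge0.
have AE : A = \big[setU/set0]_(i < N) (g @^-1` [set i] `&` A).
  rewrite -bigcup_seq; apply/seteqP; split => [omega Aomega|omega [i _ []//]].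
  by exists (g omega) => //=; rewrite mem_index_enum.
rewrite [in LHS]AE ge0_integral_bigsetU// -?AE//.
- by move=> i; exact: measurableI.
- exact: index_enum_uniq.
- by move=> i j _ _ [omega [[/= gi _] [/= gj _]]]; rewrite -gi -gj.
Qed.

(** The Markov property in product form, which also covers null histories: there [cond_prob] divides
    by zero, but both sides vanish. *)
Lemma history_prob (disp : measure_display) (Omega : measurableType disp)
    (R : realType) (P : probability Omega R) (N : nat)
    (sigma : nat -> Omega -> 'I_N) (pi0 : 'rV[R]_N) (p : 'M[R]_N) h t j :
  markov_chain P sigma pi0 p ->
  P (history sigma (extend h t j) t.+1) = ((p (h t) j)%:E * P (history sigma h t))%E.
Proof.
move=> [sigma_meas _ _ trans].
have mh : measurable (history sigma h t) by exact: measurable_history.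
rewrite historyS; have [P0|P0] := eqVneq (P (history sigma h t)) 0%E.
  rewrite P0 mule0; apply: subset_measure0 P0; last exact: subIsetr.
  - exact: measurableI.
  - exact: mh.
rewrite -(trans t h j P0) /cond_prob -/(history sigma h t).
have mI := measurableI _ _ (sigma_meas t.+1 j) mh.
have fin : fine (P (history sigma h t)) != 0.
  by rewrite fine_eq0// fin_num_measure.
rewrite -[X in (_ * X)%E]fineK ?fin_num_measure// -EFinM divfK//.
by rewrite fineK// fin_num_measure.
Qed.

(** * Trajectories along a history *)

Lemma measurable_trajectory (disp : measure_display) (Omega : measurableType disp)
    (R : realType) (d m N : nat) (f : 'I_N -> 'rV[R]_d -> 'rV[R]_m -> 'rV[R]_d)
    (sigma : nat -> Omega -> 'I_N) (w : nat -> 'rV[R]_m) x0 t (A : set 'rV[R]_d) :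
  (forall t i, measurable (sigma t @^-1` [set i])) ->
  measurable (trajectory f sigma w x0 t @^-1` A).
Proof.
move=> sigma_meas; elim: t A => [|t IH] A /=.
  by rewrite -[X in measurable X]/((fun=> x0) @^-1` A) preimage_cst; case: ifP.
(* The event is split by the mode at time [t]; the induction ranges over arbitrary sets, so it
   applies to the preimage of [A] under each [f i _ (w t)]. *)
rewrite (_ : _ @^-1` _ = \big[setU/set0]_(i < N) ((sigma t @^-1` [set i]) `&`
    (trajectory f sigma w x0 t @^-1` [set x | A (f i x (w t))]))).
  by apply: bigsetU_measurable => i _; apply: measurableI.
rewrite -bigcup_seq; apply/seteqP; split => [omega /= Af|omega [i _ [/= <-]]]//.
by exists (sigma t omega) => //=; rewrite mem_index_enum.
Qed.

Lemma measurable_fun_trajectory (disp disp' : measure_display)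
    (Omega : measurableType disp) (T : measurableType disp') (R : realType)
    (d m N : nat) (f : 'I_N -> 'rV[R]_d -> 'rV[R]_m -> 'rV[R]_d)
    (sigma : nat -> Omega -> 'I_N) (w : nat -> 'rV[R]_m) x0 t
    (F : 'rV[R]_d -> T) (D : set Omega) :
  (forall t i, measurable (sigma t @^-1` [set i])) ->
  measurable_fun D (fun omega => F (trajectory f sigma w x0 t omega)).
Proof.
move=> sigma_meas mD A _; apply: measurableI => //.
exact: (measurable_trajectory f w x0 t [set y | A (F y)]).
Qed.

(** Two sample spaces occur so that a random trajectory can be compared with one on [unit] driven by
    a deterministic sequence of modes. *)
Lemma eq_trajectory (R : realType) (d m N : nat)
    (f : 'I_N -> 'rV[R]_d -> 'rV[R]_m -> 'rV[R]_d) (Omega Omega' : Type)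
    (sigma : nat -> Omega -> 'I_N) (sigma' : nat -> Omega' -> 'I_N)
    (w : nat -> 'rV[R]_m) x0 t omega omega' :
  (forall s, (s < t)%N -> sigma s omega = sigma' s omega') ->
  trajectory f sigma w x0 t omega = trajectory f sigma' w x0 t omega'.
Proof.
elim: t => //= t IH eq_sigma; rewrite eq_sigma// IH// => s st.
by rewrite eq_sigma// leqW.
Qed.

(* x is the position at time t when the modes follow h. *)
Lemma integral_history_le (disp : measure_display) (Omega : measurableType disp)
    (R : realType) (P : probability Omega R) (d m N : nat)
    (f : 'I_N -> 'rV[R]_d -> 'rV[R]_m -> 'rV[R]_d)
    (sigma : nat -> Omega -> 'I_N) (pi0 : 'rV[R]_N) (p : 'M[R]_N)
    (V : 'I_N -> 'rV[R]_d -> R) (F : 'rV[R]_d -> R)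
    (w : nat -> 'rV[R]_m) (x0 : 'rV[R]_d) (c r : R) :
  markov_chain P sigma pi0 p -> (forall x, 0 <= F x) ->
  (forall i x, F x <= V i x) -> 0 <= c ->
  (forall i x s, \sum_(j < N) p i j * V j (f i x (w s)) <= c * V i x + (1 - c) * r) ->
  forall n t h x, x = trajectory f (fun s (_ : unit) => h s) w x0 t tt ->
    (\int[P]_(omega in history sigma h t)
        (F (trajectory f sigma w x0 (t + n) omega))%:E
     <= (c ^+ n * V (h t) x + (1 - c ^+ n) * r)%:E * P (history sigma h t))%E.
Proof.
move=> markov F_ge0 FV c_ge0 step.
have [sigma_meas [_ p_prob] _ _] := markov.
have mh h t : measurable (history sigma h t) by exact: measurable_history.
(* The first of the [n.+1] remaining steps is split off by the value [j] of [sigma t.+1], and the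
   induction hypothesis is applied to each extended history. *)
elim=> [|n IH] t h x xE.
  rewrite addn0 expr0 mul1r subrr mul0r addr0.
  rewrite (eq_integral (cst (F x)%:E)); last first.
    move=> omega /set_mem hist /=; congr (F _)%:E; rewrite xE; apply: eq_trajectory => s st.
    by rewrite hist// ltnW.
  by rewrite integral_cst// lee_wpmul2r// lee_fin.
rewrite (ge0_integral_states P (mh h t) (sigma_meas t.+1))//; last 2 first.
- exact: (measurable_fun_trajectory f w x0 (t + n.+1) (fun y => (F y)%:E)).
- by move=> omega _; rewrite lee_fin.
apply: (@le_trans _ _ (\sum_(j < N) (c ^+ n * V j (f (h t) x (w t)) +
    (1 - c ^+ n) * r)%:E * ((p (h t) j)%:E * P (history sigma h t)))%E).
  apply: lee_sum => j _; have := IH t.+1 (extend h t j) _ erefl.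
  rewrite addSnnS (history_prob _ _ _ markov) historyS /=.
  have -> : extend h t j t.+1 = j by rewrite /extend eqxx.
  have -> : extend h t j t = h t by rewrite /extend ltn_eqF.
  (* The position at time [t] involves only modes before [t], so extending the history leaves it
     equal to [x]. *)
  rewrite (@eq_trajectory _ _ _ _ _ unit unit _ (fun s _ => h s) _ _ _ _ tt).
    by rewrite -xE.
  by move=> s st; rewrite /extend ltn_eqF// ltnW.
have q_fin : P (history sigma h t) \is a fin_num by exact: fin_num_measure.
rewrite -(fineK q_fin); set q := fine _.
have q_ge0 : 0 <= q by exact: fine_ge0.
under eq_bigr do rewrite -!EFinM.
rewrite sumEFin -EFinM lee_fin.
rewrite (eq_bigr (fun j => (c ^+ n * (p (h t) j * V j (f (h t) x (w t))) +
    (1 - c ^+ n) * r * p (h t) j) * q)); last by move=> j _; ring.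
rewrite -mulr_suml ler_wpM2r// big_split /= -!mulr_sumr.
have [_ psum] := p_prob (h t).
have -> : \sum_(i < N) p (h t) i = 1 by rewrite -psum; apply: eq_bigr => i _; rewrite mxE.
have := ler_wpM2l (exprn_ge0 n c_ge0) (step (h t) x t).
rewrite mulr1 exprSr => h1.
apply: le_trans (lerD h1 (lexx _)) _.
(* Equality holds, as [c ^+ n * (1 - c) + (1 - c ^+ n) = 1 - c ^+ n * c]. *)
rewrite le_eqVlt; apply/orP; left; apply/eqP.
ring.
Qed.

(** * The one-step inequality and the stability estimate *)

Theorem proposition3p14
  (R : realType) (d m N : nat)
  (f : 'I_N -> 'rV[R]_d -> 'rV[R]_m -> 'rV[R]_d)
  (f_lip : forall i, locally_lipschitz (f i))
  (f_0 : forall i, f i 0 0 = 0)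
  (disp : measure_display) (Omega : measurableType disp)
  (P : probability Omega R)
  (sigma : nat -> Omega -> 'I_N) (pi0 : 'rV[R]_N) (p : 'M[R]_N)
  (sigma_markov : markov_chain P sigma pi0 p)
  (p_irr : irreducible p)
  (V : 'I_N -> 'rV[R]_d -> R) (alpha1 alpha2 rho : R -> R)
  (mu : R) (lambda : 'M[R]_N)
  (V_cont : forall i, continuous (V i))
  (V_ge0 : forall i x, 0 <= V i x)
  (alpha1_Koo : class_Koo alpha1)
  (alpha2_Koo : class_Koo alpha2)
  (rho_Koo : class_Koo rho)
  (mu_gt1 : 1 < mu)
  (lambda_ge0 : forall i j, 0 <= lambda i j)
  (V_bounds : forall x i, alpha1 (enorm x) <= V i x <= alpha2 (enorm x))
  (V_mu : forall x i j, V i x <= mu * V j x)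
  (V_decr : forall i j x w, rho (enorm w) < enorm x ->
     V i (f j x w) <= lambda i j * V i x)
  (contr : mu * \big[Num.max/0]_(i < N) (\sum_(j < N) p i j * lambda j i) < 1) :
  iss_L1 P f sigma.
Proof.
pose Max := \big[Num.max/0]_(i < N) (\sum_(j < N) p i j * lambda j i).
have Max_ge0 : 0 <= Max by exact: bigmax_ge_id.
have mu_gt0 : 0 < mu by exact: lt_trans mu_gt1.
(* The average with 1 keeps c positive, as class K requires of c ^+ n * alpha2. *)
pose c := (1 + mu * Max) / 2.
have muMax_ge0 : 0 <= mu * Max by rewrite mulr_ge0// ltW.
have c_gt0 : 0 < c by rewrite /c; lra.
have c_lt1 : c < 1 by move: contr; rewrite -/Max /c; lra.
have c_ge0 := ltW c_gt0.
have muMax_le : mu * Max <= c by move: contr; rewrite -/Max /c; lra.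
have [sigma_meas [[pi0_ge0 pi0_sum] p_prob] sigma0 _] := sigma_markov.
have p_ge0 i j : 0 <= p i j by have := (p_prob i).1 j; rewrite mxE.
have p_sum i : \sum_(j < N) p i j = 1.
  by rewrite -(p_prob i).2; apply: eq_bigr => j _; rewrite mxE.
have [[alpha1_ge0 _ _ _] _] := alpha1_Koo.
have [alpha2K _] := alpha2_Koo.
have V0 i : V i 0 = 0.
  have [_ _ _ alpha20] := alpha2K.
  by apply/le_anti; rewrite V_ge0 andbT -alpha20 -(enorm0 R d) (andP (V_bounds 0 i)).2.
(* The sum over all pairs dominates each [V j (f i x w)] and is still continuous and zero at the
   origin; [(1 - c)^-1] offsets the factor [1 - c] of [r] in [step]. *)
pose g (z : 'rV[R]_d * 'rV[R]_m) :=
  (1 - c)^-1 * \sum_(ij : 'I_N * 'I_N) V ij.2 (f ij.1 z.1 z.2).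
have onec_gt0 : 0 < 1 - c by rewrite subr_gt0.
have g_cont : continuous g.
  move=> z; apply: cvgMr; apply: (@cvg_big _ _ +%R) => [|-[i j] _ /=].
    exact: add_continuous.
  apply: (@cvg_comp _ _ _ (fun z => f i z.1 z.2) (V j)); last exact: V_cont.
  exact: locally_lipschitz_continuous (f_lip i) z.
have g_ge0 z : 0 <= g z.
  by rewrite mulr_ge0 ?invr_ge0 ?(ltW onec_gt0)// sumr_ge0.
have g0 : g 0 = 0.
  by rewrite /g big1 ?mulr0// => -[i j] _ /=; rewrite f_0 V0.
have [chi' chi'_Koo chi'_ub] := class_Koo_majorant g_cont g_ge0 g0 rho_Koo.
have [[chi'_ge0 _ _ _] _] := chi'_Koo.
exists alpha1, chi', (fun r n => c ^+ n * alpha2 r); split=> //.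
  by apply: class_KL_geometric; rewrite ?c_gt0.
move=> x0 w _ t; set S := ereal_sup _.
have S_ub s : ((chi' (enorm (w s)))%:E <= S)%E by apply: ereal_sup_ubound; exists s.
case: S S_ub => [r S_ub| |S_ub]; last 2 first.
(* The supremum is an extended real: for [+oo] the bound is trivial, and [-oo] cannot lie above the
   term of time 0. *)
- by move=> _; rewrite addey// leey.
- by have := S_ub 0%N.
have step i x s : \sum_(j < N) p i j * V j (f i x (w s)) <= c * V i x + (1 - c) * r.
  have chi'_r : chi' (enorm (w s)) <= r by have := S_ub s; rewrite lee_fin.
  have r_ge0 : 0 <= r by apply: le_trans chi'_r; exact: chi'_ge0 (enorm_ge0 _).
  have [x_small|x_large] := leP (enorm x) (rho (enorm (w s))).
    apply: ler_wpDl; first exact: mulr_ge0.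
    (* The bound [(1 - c) * r] is written as its own average with weights [p i j], so that the
       comparison is termwise. *)
    rewrite -[leRHS]mul1r -[X in _ <= X * _](p_sum i) mulr_suml; apply: ler_sum => j _.
    apply: ler_wpM2l => //.
    rewrite -ler_pdivrMl//; apply: le_trans chi'_r.
    apply: le_trans (chi'_ub x (w s) x_small).
    rewrite /g ler_wpM2l ?invr_ge0 ?(ltW onec_gt0)//.
    by rewrite (bigD1 (i, j))//= lerDl sumr_ge0.
  apply: ler_wpDr; first by rewrite mulr_ge0// ltW.
  apply: le_trans (_ : mu * (\sum_(j < N) p i j * lambda j i) * V i x <= _).
    rewrite mulr_sumr mulr_suml; apply: ler_sum => j _.
    rewrite mulrCA -mulrA; apply: ler_wpM2l => //.
    apply: le_trans (V_decr j i x (w s) x_large) _.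
    by rewrite mulrAC [leRHS]mulrC; apply: ler_wpM2l.
  apply: ler_wpM2r => //; apply: le_trans muMax_le; apply: ler_wpM2l; first exact: ltW.
  exact: (le_bigmax _ (fun i => \sum_(j < N) p i j * lambda j i)).
have alpha1_V i x : alpha1 (enorm x) <= V i x by have /andP[] := V_bounds x i.
have r_ge0 : 0 <= r.
  by have := S_ub 0%N; rewrite lee_fin; apply: le_trans; exact: chi'_ge0 (enorm_ge0 _).
rewrite unlock (ge0_integral_states P measurableT (sigma_meas 0%N))//; last 2 first.
- exact: (measurable_fun_trajectory f w x0 t (fun y => (alpha1 (enorm y))%:E)).
- by move=> omega _; rewrite lee_fin alpha1_ge0// enorm_ge0.
(* With [V i x0 <= alpha2 (enorm x0)] and [1 - c ^+ t <= 1] the bound is the same for every initial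
   mode [i], and the weights [pi0] sum to one. *)
apply: (@le_trans _ _
    (\sum_(i < N) ((c ^+ t * alpha2 (enorm x0) + r) * pi0 ord0 i)%:E)%E); last first.
  by rewrite sumEFin -mulr_sumr pi0_sum mulr1 EFinD.
apply: lee_sum => i _.
(* Fixing the initial mode is a history up to time 0, from which [t] steps remain. *)
have histE : history sigma (fun=> i) 0%N = sigma 0%N @^-1` [set i] `&` setT.
  rewrite setIT; apply/seteqP; split => [omega|omega s_i s]; first exact.
  by rewrite leqn0 => /eqP ->.
have := integral_history_le (x0 := x0) sigma_markov
  (fun x => alpha1_ge0 _ (enorm_ge0 x)) alpha1_V c_ge0 step t (h := fun=> i) (t := 0%N) erefl.
rewrite histE setIT sigma0 add0n => /le_trans; apply; rewrite -EFinM lee_fin.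
apply: ler_wpM2r => //; apply: lerD.
  by rewrite ler_wpM2l ?exprn_ge0// (andP (V_bounds x0 i)).2.
by rewrite -[leRHS]mul1r ler_wpM2r// gerBl exprn_ge0.
Qed.
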